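(* Let $G$ be a sum basic equilibrium graph. If $G$ is a block graph, then the diameter of $G$ is at most $2$.
   Context: Graphs are finite, simple and undirected. For a graph $G$ and a vertex $u$, let $D_G(u)=\sum_{v\ne u} d_G(u,v)$ if $G$ is connected and $D_G(u)=\infty$ otherwise, where $d_G$ is the graph distance. A deviation (swap) in $u$ replaces an edge $uv\in E(G)$ by $uv'$, where $v'\in V(G)\setminus\{u,v\}$ is any other node; the deviated graph $G'$ is the simple graph with edge set $(E(G)\setminus\{uv\})\cup\{uv'\}$ (so if $uv'$ is already an edge, the swap just deletes $uv$). The cost difference of the deviation is $D_{G'}(u)-D_G(u)$. A graph $G$ is a sum basic equilibrium (also called a sum equilibrium graph in the basic network-creation game) if it is connected and for every vertex $u$ and every deviation in $u$ the cost difference is non-negative. A block graph (clique tree) is a connected graph all of whose blocks (maximal connected subgraphs having no cut vertex of their own) are cliques. *)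

(* Defs.v *)
From HB Require Import structures.
From mathcomp Require Import all_boot all_order all_algebra.
From mathcomp Require Import constructive_ereal.

Set Implicit Arguments.
Unset Strict Implicit.
Unset Printing Implicit Defensive.

(* A graph with vertex set T is a symmetric irreflexive relation e : rel T;
   one with vertex set A : {set T} is a pair (A, f) where f : rel T only
   relates elements of A. *)

Section Graphs.

Variable T : finType.
Implicit Types (e f g : rel T) (A B : {set T}) (u v x y z : T).

Definition simple_graph e : Prop := symmetric e /\ irreflexive e.

Definition connected A f : bool :=
  [forall x in A, forall y in A, connect f x y].

Definition walk e (n : nat) x y : bool :=
  [exists p : n.-tuple T, path e x p && (last x p == y)].

(* The least length of a walk from x to y; a shortest walk has fewer than
   #|T| edges. If y is unreachable from x this is the junk value #|T|, which
   does not matter below since only connected graphs are measured. *)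
Definition dist e x y : nat :=
  find (fun n => walk e n x y) (iota 0 #|T|).

Definition diameter e : nat := \max_(x : T) \max_(y : T) dist e x y.

Definition cost e u : \bar int :=
  if connected [set: T] e then
    (Posz (\sum_(v | v != u) dist e u v)%N)%:E%E
  else +oo%E.

Definition swap e u v v' : rel T :=
  [rel x y | e x y && ([set x; y] != [set u; v]) || ([set x; y] == [set u; v'])].

(* For connected e, [cost e u] is finite, so this is never +oo - +oo. *)
Definition cost_difference e u v v' : \bar int :=
  (cost (swap e u v v') u - cost e u)%E.

Definition sum_basic_equilibrium e : Prop :=
  connected [set: T] e /\
  forall u v v', e u v -> v' != u -> v' != v ->
    (0 <= cost_difference e u v v')%E.

Definition subgraph e A f : Prop :=
  [/\ symmetric f, subrel f e & forall x y, f x y -> x \in A].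

Definition delete_vertex f x : rel T :=
  [rel y z | [&& f y z, y != x & z != x]].

Definition cut_vertex A f x : Prop :=
  x \in A /\
  exists y z, [/\ y \in A :\ x, z \in A :\ x,
                  connect f y z & ~~ connect (delete_vertex f x) y z].

Definition nonseparable A f : Prop :=
  connected A f /\ forall x, ~ cut_vertex A f x.

Definition block e A f : Prop :=
  [/\ subgraph e A f, nonseparable A f &
      forall B g, subgraph e B g -> nonseparable B g ->
        A \subset B -> subrel f g -> B = A /\ g =2 f].

Definition complete A f : Prop :=
  {in A &, forall x y, x != y -> f x y}.

Definition block_graph e : Prop :=
  connected [set: T] e /\ forall A f, block e A f -> complete A f.

Lemma walkP e n x y :
  reflect (exists p, [/\ path e x p, last x p = y & size p = n]) (walk e n x y).
Proof.
apply: (iffP existsP) => [[p /andP[ep /eqP lp]]|[p [ep lp sp]]].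
  by exists (tval p); rewrite size_tuple.
have sp' : size p == n by apply/eqP.
by exists (Tuple sp'); rewrite /= ep lp eqxx.
Qed.

Lemma dist_walk e x y : connect e x y -> walk e (dist e x y) x y.
Proof.
move=> /connectP[p ep ->]; case/shortenP: ep => p' ep' up' _.
have lt_p' : (size p' < #|T|)%N.
  by have := max_card (mem (x :: p')); rewrite (card_uniqP up').
set P := fun n => walk e n x (last x p').
have hP : has P (iota 0 #|T|).
  apply/hasP; exists (size p'); first by rewrite mem_iota.
  by apply/walkP; exists p'.
have := nth_find 0 hP; rewrite nth_iota ?add0n //.
by rewrite -[X in (_ < X)%N](size_iota 0) -has_find.
Qed.

Lemma dist_min e x y p : path e x p -> last x p = y -> (dist e x y <= size p)%N.
Proof.
move=> ep lp; rewrite leqNgt; apply/negP => lt_pd.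
have := before_find 0 lt_pd; rewrite nth_iota ?add0n.
  by move/walkP; apply; exists p.
apply: leq_trans lt_pd _; rewrite -[X in (_ <= X)%N](size_iota 0).
exact: find_size.
Qed.

Lemma swap_simple e u v v' :
  simple_graph e -> v' != u -> simple_graph (swap e u v v').
Proof.
move=> [se ie] v'u; split=> [x y|x]; rewrite /swap /=.
  by rewrite se [[set x; y]]setUC.
rewrite ie /= setUid; apply/negbTE/eqP => h.
have := cards2 u v'; rewrite -h cards1 eq_sym => /eqP.
by rewrite eq_sym v'u.
Qed.

End Graphs.

(* Main.v *)
Require Import Defs.
From mathcomp Require Import all_boot.
From mathcomp Require Import all_algebra constructive_ereal zify.

Set Implicit Arguments.
Unset Strict Implicit.
Unset Printing Implicit Defensive.

(** The proof compares the effects of two swaps.  If the diameter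
    exceeds 2, then a shortest path between two vertices at distance at least 3
    starts with edges v a, a b, b w where v, b are distinct and not adjacent, and so
    are a, w.  For such a path let
      - X = [far_from v b] be the set of vertices x with d(v,x) = d(b,x) + 2,
      - Y = [fork v a b] be the set of x with d(v,x) = d(b,x) = d(a,x) + 1.
    When v replaces its edge to a by an edge to b, it gets closer to every
    element of X, moves away by at most 1 from every element of Y, and from
    no other vertex; so #|X| <= #|Y| in every equilibrium graph
    ([card_far_from_le_fork]).

    In a block graph two distinct non-adjacent neighbours a, w of b are
    separated by b: otherwise a, b, w lie on a cycle, which is nonseparable,
    hence contained in a block, hence a and w would be adjacent
    ([block_graph_separates]).  Consequently a vertex x that is closer to a
    than to b satisfies d(w,x) = d(b,x) + 1 ([block_graph_dist]), so
    that [fork v a b] is contained in [far_from w a]; the inclusion is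
    strict because v belongs only to the latter.

    Both facts also hold for the reversed path w, b, a, v, and give the
    contradictory chain
      #|far_from v b| <= #|fork v a b| < #|far_from w a|
                      <= #|fork w b a| < #|far_from v b|. *)

(** * Distances in a connected graph *)

Section Distance.

Variables (T : finType) (e : rel T).
Hypothesis e_conn : connected [set: T] e.

Lemma connectedT x y : connect e x y.
Proof. by move/forall_inP/(_ x (in_setT x))/forall_inP/(_ y (in_setT y)): e_conn. Qed.

Lemma shortest_path x y :
  exists p, [/\ path e x p, last x p = y & size p = dist e x y].
Proof. exact/walkP/dist_walk/connectedT. Qed.

Lemma dist_edge x y z : e x y -> dist e x z <= (dist e y z).+1.
Proof.
move=> exy; have [p [ep lp <-]] := shortest_path y z.
by apply: (@dist_min _ _ _ _ (y :: p)) => //=; rewrite exy.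
Qed.

Lemma dist_self x : dist e x x = 0.
Proof. by apply/eqP; rewrite -leqn0; exact: (@dist_min _ _ _ _ [::]). Qed.

Lemma dist_edge1 x y : x != y -> e x y -> dist e x y = 1.
Proof.
move=> xy exy; have := dist_edge y exy; rewrite dist_self.
have [[|z p] [_ lp <-]] := shortest_path x y; last by case: p {lp}.
by move: lp xy => /= ->; rewrite eqxx.
Qed.

Lemma dist_nonadjacent x y : x != y -> ~~ e x y -> 1 < dist e x y.
Proof.
move=> xy nexy; have [[|z [|t p]] [/= ep lp <-]] := shortest_path x y => //.
  by rewrite lp eqxx in xy.
by move: ep; rewrite lp andbT (negPf nexy).
Qed.

Lemma dist_mem_path x z p : path e x p -> z \in x :: p ->
  dist e z (last x p) <= size p.
Proof.
rewrite inE => ep /predU1P[->|zp]; first exact: dist_min ep _.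
case/path.splitP: zp ep => p1 p2; rewrite cat_path last_cat last_rcons size_cat => /andP[_ ep].
by apply: leq_trans (dist_min ep erefl) _; rewrite leq_addl.
Qed.

(** Only the starting point of a path can be as far away from its end as the
    path is long. *)
Lemma dist_mem_tail x z p : path e x p -> z \in p ->
  dist e z (last x p) < size p.
Proof. by case: p => //= y p /andP[_ ep] zp; rewrite ltnS dist_mem_path. Qed.

End Distance.

(** * Cycles and blocks *)

Section Blocks.

Variables (T : finType) (e : rel T).
Hypothesis e_sym : symmetric e.
Implicit Types (A B : {set T}) (f g : rel T).

(** The edge relation of the subgraph of [e] induced by [A]. *)
Definition induced A : rel T := [rel x y | [&& e x y, x \in A & y \in A]].

Lemma induced_subgraph A : subgraph e A (induced A).
Proof.
split=> [x y|x y|x y]; rewrite /induced /=.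
- by rewrite e_sym; congr andb; rewrite andbC.
- by case/andP.
- by case/and3P.
Qed.

(** A boolean form of [nonseparable], for use with finite maxima. *)
Definition nonseparableb A f : bool :=
  connected A f &&
  [forall x, forall y in A :\ x, forall z in A :\ x,
     (x \in A) ==> connect (delete_vertex f x) y z].

Lemma nonseparableP A f : reflect (nonseparable A f) (nonseparableb A f).
Proof.
apply: (iffP andP) => -[cA sA]; split=> //.
  move=> x [xA [y [z [yA zA _ /negP[]]]]].
  by move/forallP/(_ x)/forall_inP/(_ y yA)/forall_inP/(_ z zA)/implyP/(_ xA): sA.
apply/forallP=> x; apply/forall_inP=> y yA; apply/forall_inP=> z zA.
apply/implyP=> xA; apply/negPn/negP=> nyz; apply: (sA x); split=> //.
exists y, z; split=> //.
move: yA zA; rewrite !inE => /andP[_ yA] /andP[_ zA].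
by move/forall_inP/(_ y yA)/forall_inP/(_ z zA): cA.
Qed.

Lemma nonseparable_mono A f g :
  subrel f g -> nonseparableb A f -> nonseparableb A g.
Proof.
move=> fg /andP[cA sA]; apply/andP; split.
  apply/forall_inP=> x xA; apply/forall_inP=> y yA.
  move/forall_inP/(_ x xA)/forall_inP/(_ y yA): cA.
  by apply: connect_sub => {x xA y yA} x y /fg; apply: connect1.
apply/forallP=> x; apply/forall_inP=> y yA; apply/forall_inP=> z zA.
apply/implyP=> xA.
move/forallP/(_ x)/forall_inP/(_ y yA)/forall_inP/(_ z zA)/implyP/(_ xA): sA.
apply: connect_sub => {yA zA} s t /and3P[/fg gst sx tx].
by apply: connect1; rewrite /delete_vertex /= gst sx.
Qed.

(** The block is induced by a largest superset of [A] inducing a nonseparable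
    graph; it is maximal among all subgraphs because a nonseparable graph
    stays so when edges are added on the same vertex set. *)
Lemma sub_block A : nonseparableb A (induced A) ->
  exists2 B : {set T}, A \subset B & block e B (induced B).
Proof.
move=> nsA.
pose P B := (A \subset B) && nonseparableb B (induced B).
have PA : P A by rewrite /P subxx.
case: (arg_maxnP (fun B : {set T} => #|B|) PA) => B /andP[AB nsB] maxB.
exists B => //; split; [exact: induced_subgraph | exact/nonseparableP |].
move=> C g [gs ge gC] /nonseparableP nsC BC Bg.
have g_ind : subrel g (induced C).
  by move=> x y gxy; rewrite /induced /= (ge _ _ gxy) (gC _ _ gxy) (gC y x) // gs.
have PC : P C by rewrite /P (subset_trans AB BC) (nonseparable_mono g_ind nsC).
have /eqP BCE : B == C by rewrite eqEcard BC; exact: maxB.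
subst C; split=> // x y; apply/idP/idP; [exact: g_ind | exact: Bg].
Qed.

Lemma nonseparable_cycle (s : seq T) :
  uniq s -> cycle e s -> nonseparableb [set x in s] (induced [set x in s]).
Proof.
move=> Us es; set A := [set x in s]; set f := induced A.
have fs : cycle f s.
  apply: (sub_in_cycle (P := mem s) _ _ es); last exact/allP.
  by move=> x y xs ys exy; apply/and3P; rewrite !inE.
have f_sym : symmetric f by have [] := induced_subgraph A.
have fdel_sym x : symmetric (delete_vertex f x).
  by move=> y z; rewrite /delete_vertex /= f_sym [(y != x) && _]andbC.
apply/andP; split.
  apply/forall_inP=> x; rewrite inE => xs; apply/forall_inP=> y; rewrite inE => ys.
  have [i p rotE] := rot_to xs.
  move: fs; rewrite -(rot_cycle i) rotE => /path_connect; apply.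
  by rewrite -rcons_cons mem_rcons inE -rotE mem_rot ys orbT.
apply/forallP=> x; apply/forall_inP=> y /setD1P[yx].
rewrite inE => ys; apply/forall_inP=> z /setD1P[zx]; rewrite inE => zs.
apply/implyP; rewrite inE => xs; have [i p rotE] := rot_to xs.
have memp t : t != x -> t \in s -> t \in p.
  by move=> tx; rewrite -(mem_rot i) rotE inE (negPf tx).
move: fs Us; rewrite -(rot_cycle i) -(rot_uniq i) rotE /= => fp /andP[xp _].
(* Without its vertex x, the cycle is still the path t :: q. *)
case: p {rotE} memp xp fp => [|t q] memp xp.
  by have := memp y yx ys.
rewrite /= rcons_path => /and3P[_ ftq _].
have dtq : path (delete_vertex f x) t q.
  apply: (sub_in_path (P := predC1 x) _ _ ftq).
    by move=> r r' rx r'x frr'; apply/and3P.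
  by apply/allP=> r rtq; apply: contraNneq xp => <-.
apply: connect_trans (path_connect dtq (memp z zx zs)).
by rewrite (sym_connect_sym (fdel_sym x)) (path_connect dtq) ?memp.
Qed.

Hypothesis e_irr : irreflexive e.
Hypothesis e_block : block_graph e.

(** In a block graph, two distinct non-adjacent neighbours [a], [w] of [b]
    are separated by [b]. *)
Lemma block_graph_separates a b w p :
  e a b -> e b w -> a != w -> ~~ e a w ->
  path e a p -> last a p = w -> b \in a :: p.
Proof.
move=> eab ebw aw neaw ep lp; apply/negPn/negP=> bp.
case/shortenP: ep lp => q eq Uq qp lq.
have bq : b \notin a :: q.
  apply: contra bp; rewrite !inE => /predU1P[->|/qp ->]; first by rewrite eqxx.
  by rewrite orbT.
have cyc : cycle e [:: b, a & q].
  by rewrite /= rcons_path e_sym eab eq lq e_sym ebw.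
have Ucyc : uniq [:: b, a & q] by rewrite cons_uniq bq.
have [B sB bB] := sub_block (nonseparable_cycle Ucyc cyc).
have aB : a \in B by apply: (subsetP sB); rewrite !inE eqxx orbT.
have wB : w \in B.
  by apply: (subsetP sB); rewrite 2!inE -lq mem_last orbT.
have /(_ a w aB wB aw)/andP[eaw _] := e_block.2 _ _ bB.
by rewrite eaw in neaw.
Qed.

Lemma block_graph_dist a b w x :
  e a b -> e b w -> a != w -> ~~ e a w ->
  dist e b x = (dist e a x).+1 -> dist e w x = (dist e b x).+1.
Proof.
move=> eab ebw aw neaw dbx; have e_conn := e_block.1.
apply/eqP; rewrite eqn_leq dist_edge 1?e_sym //=.
have [p [ep lp sp]] := shortest_path e_conn a x.
have [q [eq lq sq]] := shortest_path e_conn w x.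
have eqr : path e x (rev (belast w q)).
  by rewrite -lq rev_path (eq_path (e' := e)) // => y z; rewrite e_sym.
have := @block_graph_separates a b w (p ++ rev (belast w q)) eab ebw aw neaw.
rewrite cat_path ep lp eqr last_cat lp => /(_ isT) bpq.
have {bpq} : b \in a :: p ++ rev (belast w q).
  apply: bpq; case: q lq {sq eq eqr} => [|y q] /=; first by move=> ->.
  by rewrite rev_cons last_rcons.
rewrite -cat_cons mem_cat mem_rev => /orP[bp|/mem_belast].
  by have := dist_mem_path ep bp; rewrite lp sp dbx ltnn.
rewrite inE => /predU1P[bw|bq]; first by rewrite bw e_irr in ebw.
by rewrite -sq -lq dist_mem_tail.
Qed.

End Blocks.

(** * The effect of a swap on distances *)

Section Swap.

Variables (T : finType) (e : rel T).
Hypothesis e_simple : simple_graph e.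
Hypothesis e_equil : sum_basic_equilibrium e.

(** The vertices that are two steps farther from [v] than from [b]. *)
Definition far_from v b : {set T} := [set x | dist e v x == (dist e b x).+2].

(** The vertices that are one step closer to [a] than to both [v] and [b]. *)
Definition fork v a b : {set T} :=
  [set x | (dist e v x == (dist e a x).+1) && (dist e b x == (dist e a x).+1)].

Lemma swap_path v a b c s p : c \in [set v; a] ->
  path e s p -> c \notin s :: p -> path (swap e v a b) s p.
Proof.
move=> cva ep cp; apply: (sub_in_path (P := predC1 c) _ _ ep).
  move=> x y; rewrite !inE => xc yc exy; rewrite /swap /= exy /=; apply/orP; left.
  apply/eqP=> /setP/(_ c); rewrite cva !inE => /orP[] /eqP cE.
    by rewrite cE eqxx in xc.
  by rewrite cE eqxx in yc.
by apply/allP=> x xp; apply: contraNneq cp => <-.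
Qed.

Lemma swap_new_edge v a b : swap e v a b v b.
Proof. by rewrite /swap /= eqxx orbT. Qed.

Lemma swap_walk v a b x : e v a -> e a b -> b != v ->
  exists p, [/\ path (swap e v a b) v p, last v p = x &
                size p + (x \in far_from v b) <= dist e v x + (x \in fork v a b)].
Proof.
move=> eva eab bv; have [e_sym e_irr] := e_simple; have e_conn := e_equil.1.
have dva := dist_edge e_conn x eva; have dab := dist_edge e_conn x eab.
have dba : dist e b x <= (dist e a x).+1 by apply: dist_edge; rewrite 1?e_sym.
have ab : a != b by apply: contraTneq eab => ->; rewrite e_irr.
have va : v != a by apply: contraTneq eva => ->; rewrite e_irr.
have vin : v \in [set v; a] by rewrite !inE eqxx.
have ain : a \in [set v; a] by rewrite !inE eqxx orbT.
rewrite !inE; case: (leqP (dist e v x) (dist e a x)) => dvx.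
  (* The old shortest path from v avoids a. *)
  have [p [ep lp sp]] := shortest_path e_conn v x.
  exists p; split=> //; last by lia.
  apply: (swap_path _ ain ep); rewrite inE negb_or eq_sym va /=.
  apply/negP=> ap; have := dist_mem_tail ep ap; rewrite lp; lia.
case: (leqP (dist e b x) (dist e a x)) => dbx.
  (* The new edge followed by a shortest path from b. *)
  have [p [ep lp sp]] := shortest_path e_conn b x.
  exists (b :: p); split=> //; last by rewrite /= sp; lia.
  rewrite /= swap_new_edge (swap_path _ vin ep) //.
  apply/negP=> vp; have := dist_mem_path ep vp; rewrite lp; lia.
(* The new edge, the edge from b to a, and a shortest path from a. *)
have [p [ep lp sp]] := shortest_path e_conn a x.
exists [:: b, a & p]; split=> //; last by rewrite /= sp; lia.
rewrite /= swap_new_edge (swap_path _ vin ep).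
  rewrite andbT; apply/orP; left; rewrite e_sym eab /=.
  apply/eqP=> /setP/(_ v); rewrite !inE eqxx (negPf va) orbF /=.
  by rewrite eq_sym (negPf bv).
apply/negP=> vp; have := dist_mem_path ep vp; rewrite lp; lia.
Qed.

Lemma equilibrium_sum_dist v a b : e v a -> b != v -> b != a ->
  connected [set: T] (swap e v a b) ->
  \sum_(x | x != v) dist e v x <= \sum_(x | x != v) dist (swap e v a b) v x.
Proof.
move=> eva bv ba swap_conn; have := e_equil.2 v a b eva bv ba.
rewrite /cost_difference /cost swap_conn e_equil.1 -EFinB lee_fin.
by rewrite Num.Theory.subr_ge0.
Qed.

Lemma card_far_from_le_fork v a b : e v a -> e a b -> v != b ->
  #|far_from v b| <= #|fork v a b|.
Proof.
move=> eva eab vb; have [e_sym e_irr] := e_simple; have e_conn := e_equil.1.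
have ba : b != a by apply: contraTneq eab => ->; rewrite e_irr.
have bv : b != v by rewrite eq_sym.
set e' := swap e v a b.
have e'_sym : symmetric e' by have [] := swap_simple a e_simple bv.
have reach x : connect e' v x.
  have [p [ep lp _]] := swap_walk x eva eab bv.
  by apply/connectP; exists p.
have e'_conn : connected [set: T] e'.
  apply/forall_inP=> x _; apply/forall_inP=> y _.
  by apply: connect_trans (reach y); rewrite sym_connect_sym.
have sum_le := equilibrium_sum_dist eva bv ba e'_conn.
have vfar : v \notin far_from v b by rewrite inE dist_self.
have sum_card (A : {set T}) : v \notin A -> #|A| = \sum_(x | x != v) (x \in A).
  move=> vA; rewrite -sum1_card big_mkcond (bigD1 v) //= (negPf vA) add0n.
  by apply: eq_bigr => x _; case: (x \in A).
have vfork : v \notin fork v a b by rewrite inE dist_self.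
rewrite -(leq_add2l (\sum_(x | x != v) dist e v x)).
apply: leq_trans (leq_add sum_le (leqnn _)) _.
rewrite !sum_card // -!big_split; apply: leq_sum => x _ /=.
have [p [ep lp]] := swap_walk x eva eab bv.
by apply: leq_trans; rewrite leq_add2r; apply: dist_min ep lp.
Qed.

End Swap.

(** * Block graphs in equilibrium *)

Lemma card_fork_lt_far_from (T : finType) (e : rel T) v a b w :
  simple_graph e -> block_graph e ->
  e v a -> e a b -> e b w ->
  v != b -> ~~ e v b -> a != w -> ~~ e a w ->
  #|fork e v a b| < #|far_from e w a|.
Proof.
move=> [e_sym e_irr] e_block eva eab ebw vb nevb aw neaw.
have e_conn := e_block.1; apply: proper_card.
have dist_w x : dist e b x = (dist e a x).+1 -> x \in far_from e w a.
  move=> dbx; rewrite inE.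
  by rewrite (block_graph_dist e_sym e_irr e_block eab ebw aw neaw dbx) dbx.
apply/properP; split.
  by apply/subsetP=> x; rewrite inE => /andP[_ /eqP/dist_w].
exists v; last by rewrite inE dist_self.
apply: dist_w.
have av : a != v by apply: contraTneq eva => ->; rewrite e_irr.
have dav : dist e a v = 1 by apply: dist_edge1 => //; rewrite e_sym.
have dbv : 1 < dist e b v by apply: dist_nonadjacent; rewrite 1?eq_sym // e_sym.
have : dist e b v <= (dist e a v).+1 by apply: dist_edge; rewrite 1?e_sym.
lia.
Qed.

Theorem corollary7 (T : finType) (e : rel T) :
  simple_graph e -> sum_basic_equilibrium e -> block_graph e ->
  (diameter e <= 2)%N.
Proof.
move=> e_simple e_equil e_block; have [e_sym _] := e_simple.
have e_conn := e_block.1.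
apply/bigmax_leqP=> v _; apply/bigmax_leqP=> y _; rewrite leqNgt; apply/negP.
have [[|a [|b [|w p]]] [ep lp dp]] := shortest_path e_conn v y; try by rewrite -dp.
move=> _; move: ep => /= /and4P[eva eab ebw ep].
(* Each coincidence or chord among the first vertices would give a shortcut. *)
have short q : path e v q -> last v q = y -> 2 < size q - size p.
  by move=> eq lq; have := dist_min eq lq; rewrite -dp /=; lia.
have vb : v != b.
  apply/eqP=> vb; have := short (w :: p); rewrite /= {1}vb ebw ep => /(_ isT lp).
  by lia.
have nevb : ~~ e v b.
  apply/negP=> evb; have := short [:: b, w & p].
  by rewrite /= evb ebw ep => /(_ isT lp); lia.
have aw : a != w.
  apply/eqP=> aw; have := short (a :: p).
  by rewrite /= eva {1 2}aw ep => /(_ isT lp); lia.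
have neaw : ~~ e a w.
  apply/negP=> eaw; have := short [:: a, w & p].
  by rewrite /= eva eaw ep => /(_ isT lp); lia.
have lt_a := card_fork_lt_far_from e_simple e_block eva eab ebw vb nevb aw neaw.
have lt_b : #|fork e w b a| < #|far_from e v b|.
  by apply: (card_fork_lt_far_from (w := v)); rewrite 1?e_sym // eq_sym.
have le_a := card_far_from_le_fork e_simple e_equil eva eab vb.
have le_b : #|far_from e w a| <= #|fork e w b a|.
  by apply: card_far_from_le_fork; rewrite 1?e_sym // eq_sym.
lia.
Qed.
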